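(* Let $A(t)=\sum_{n\ge 0}A_n\frac{t^n}{n!}$ be a formal power series with complex coefficients, and let $(\beta_k)_{k\ge 0}$ be complex numbers such that $$\frac{A'(t)}{A(t)}=\sum_{k=0}^{\infty}\beta_k\frac{t^k}{k!}.$$ Let $a,b,c,x\in\mathbb{C}$ with $c\notin\{0,-1,-2,\dots\}$. Then for every $n\ge 0$ the Gauss-Appell polynomials satisfy $${}_{{}_2F_1}A_{n+1}(a,b;c;x)=\frac{abx}{c}\,{}_{{}_2F_1}A_{n}(a+1,b+1;c+1;x)+\sum_{k=0}^{n}\binom{n}{k}\beta_k\;{}_{{}_2F_1}A_{n-k}(a,b;c;x).$$
   Context: $(r)_k=r(r+1)\cdots(r+k-1)$, $(r)_0=1$, is the Pochhammer symbol. Umbral convention: $\hat\chi$ and $\hat a$ are commuting symbols. For a polynomial $P$ in $\hat\chi,\hat a$ with complex coefficients, $P\,\phi_0\psi_0$ denotes the complex number obtained by expanding $P$ in monomials and applying the linear functional determined by $\hat\chi^k\hat a^j\,\phi_0\psi_0=\frac{(a)_k(b)_k}{(c)_k}A_j$ for all $k,j\ge 0$. The Gauss-Appell polynomials associated with $A(t)$ are defined for $n\ge 0$ by ${}_{{}_2F_1}A_n(a,b;c;x)=(x\hat\chi+\hat a)^n\phi_0\psi_0$, that is, ${}_{{}_2F_1}A_n(a,b;c;x)=\sum_{k=0}^{n}\binom{n}{k}\frac{(a)_k(b)_k}{(c)_k}x^kA_{n-k}$. The polynomials with parameters $(a+1,b+1;c+1)$ are formed with the same $A(t)$. The relation $A'(t)/A(t)=\sum_k\beta_kt^k/k!$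 is understood in formal power series, i.e. $A'(t)=A(t)\sum_{k}\beta_kt^k/k!$. *)

(* Defs.v *)
From HB Require Import structures.
From mathcomp Require Import all_boot all_order all_algebra.
From mathcomp Require Import reals complex ssrcomplements mpoly.

Set Implicit Arguments.
Unset Strict Implicit.
Unset Printing Implicit Defensive.

Import GRing.Theory.
Local Open Scope ring_scope.

Section FormalPowerSeries.
Variable F : fieldType.

(* A formal power series is encoded by its sequence of coefficients:
   f stands for \sum_n (f n) t^n. *)
Definition fps := nat -> F.

Definition fps_mul (f g : fps) : fps :=
  fun n => \sum_(i < n.+1) f i * g (n - i)%N.

Definition fps_deriv (f : fps) : fps := fun n => n.+1%:R * f n.+1.

(* \sum_n u_n t^n / n! *)
Definition egf (u : nat -> F) : fps := fun n => u n / n`!%:R.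

End FormalPowerSeries.

Section GaussAppell.
Variable F : fieldType.
Implicit Types (a b c x : F) (A : nat -> F) (P Q : {mpoly F[2]}).

Definition pochhammer (r : F) (k : nat) : F := \prod_(i < k) (r + i%:R).

(* The two commuting umbral symbols are the variables of {mpoly F[2]}. *)
Definition chi_hat : {mpoly F[2]} := 'X_ord0.
Definition a_hat : {mpoly F[2]} := 'X_ord_max.

Definition umbral_moment a b c A (k j : nat) : F :=
  pochhammer a k * pochhammer b k / pochhammer c k * A j.

(* P phi_0 psi_0 *)
Definition umbral a b c A P : F :=
  \sum_(m <- msupp P) P@_m * umbral_moment a b c A (m ord0) (m ord_max).

Definition gauss_appell A (n : nat) a b c x : F :=
  umbral a b c A ((x *: chi_hat + a_hat) ^+ n).

Lemma umbralwE a b c A P d : (msize P <= d)%N ->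
  umbral a b c A P = \sum_(m : 'X_{1..2 < d})
    P@_m * umbral_moment a b c A ((m : 'X_{1..2}) ord0)
                                 ((m : 'X_{1..2}) ord_max).
Proof.
move=> leP; pose I := 'X_{1..2 < d}.
rewrite /umbral (big_mksub I) //=; first last.
- by move=> m /msize_mdeg_lt /leq_trans; apply.
- exact: msupp_uniq.
rewrite big_rmcond //= => m mP.
by rewrite memN_msupp_eq0 // mul0r.
Qed.

Lemma umbral_is_linear a b c A : linear (umbral a b c A : _ -> F^o).
Proof.
move=> r P Q; pose d := maxn (msize (r *: P + Q)) (maxn (msize P) (msize Q)).
rewrite !(@umbralwE _ _ _ _ _ d) ?leq_max ?leqnn ?orbT //.
rewrite /GRing.scale /= mulr_sumr -big_split /=; apply: eq_bigr => m _.
by rewrite mcoeffD mcoeffZ mulrDl -(mulrA r).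
Qed.

HB.instance Definition _ a b c A :=
  GRing.isLinear.Build F {mpoly F[2]} F^o _ (umbral a b c A)
    (umbral_is_linear a b c A).

Lemma umbral_monomial a b c A (k j : nat) :
  umbral a b c A (chi_hat ^+ k * a_hat ^+ j) = umbral_moment a b c A k j.
Proof.
rewrite /chi_hat /a_hat !mpolyXn -mpolyXD /umbral msuppX big_seq1 mcoeffX eqxx.
by rewrite mul1r !mnmDE !mulmnE !mnmE /= mul1n mul0n addn0 mul0n mul1n add0n.
Qed.

Lemma gauss_appellE A n a b c x :
  gauss_appell A n a b c x =
  \sum_(k < n.+1) 'C(n, k)%:R
    * (pochhammer a k * pochhammer b k / pochhammer c k) * x ^+ k * A (n - k)%N.
Proof.
rewrite /gauss_appell addrC exprDn linear_sum; apply: eq_bigr => k _ /=.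
rewrite raddfMn /= exprZn -scalerAr linearZ /= mulrC umbral_monomial.
rewrite /umbral_moment /GRing.scale /= -[LHS]mulr_natl -!mulrA.
by congr (_ * _); rewrite [LHS]mulrC -!mulrA [A _ * _]mulrC.
Qed.

End GaussAppell.

(* Main.v *)
(* In terms of exponential generating functions, with u_k = (a)_k (b)_k / (c)_k x^k,
   the Gauss-Appell polynomials have generating function U(t) A(t), whose
   derivative is U' A + U A' = U' A + U A B.  The coefficients of U' are a b x / c
   times those of U with every parameter raised by 1. *)
Require Import Defs.
From mathcomp Require Import all_boot all_order all_algebra.
From mathcomp Require Import reals complex.
From mathcomp Require Import ring.

Import GRing.Theory.
Local Open Scope ring_scope.
Local Open Scope complex_scope.

(** This is the product of exponential generating functions, read on coefficient sequences; there,
    differentiation is the index shift [fun k => u k.+1]. *)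
Definition binom_conv {R : nzRingType} (u v : nat -> R) (n : nat) : R :=
  \sum_(k < n.+1) 'C(n, k)%:R * u k * v (n - k)%N.

Lemma eq_binom_convl (R : nzRingType) (u u' v : nat -> R) n :
  u =1 u' -> binom_conv u v n = binom_conv u' v n.
Proof. by move=> e; apply: eq_bigr => k _; rewrite e. Qed.

Lemma eq_binom_convr (R : nzRingType) (u v v' : nat -> R) n :
  v =1 v' -> binom_conv u v n = binom_conv u v' n.
Proof. by move=> e; apply: eq_bigr => k _; rewrite e. Qed.

Lemma binom_convDr (R : nzRingType) (u v w : nat -> R) n :
  binom_conv u (fun k => v k + w k) n = binom_conv u v n + binom_conv u w n.
Proof. by rewrite -big_split; apply: eq_bigr => k _; rewrite /= mulrDr. Qed.

Lemma binom_convZl (R : comNzRingType) (r : R) (u v : nat -> R) n :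
  binom_conv (fun k => r * u k) v n = r * binom_conv u v n.
Proof. by rewrite mulr_sumr; apply: eq_bigr => k _; ring. Qed.

(** The Leibniz rule for a product of generating functions; on coefficients it is Pascal's rule. *)
Lemma binom_convS (R : nzRingType) (u v : nat -> R) n :
  binom_conv u v n.+1 =
  binom_conv (fun k => u k.+1) v n + binom_conv u (fun k => v k.+1) n.
Proof.
rewrite {1}/binom_conv big_ord_recl /= !bin0 subn0 addrC.
under eq_bigr => k _ do rewrite /bump leq0n add1n binS subSS natrD addrC !mulrDl.
rewrite big_split /= -addrA; congr (_ + _).
(* The top term carries ['C(n, n.+1) = 0]; the rest, with the [k = 0] term set aside earlier, form
   the sum with [v] shifted. *)
rewrite big_ord_recr /= bin_small // !mul0r addr0 addrC.
rewrite [RHS]big_ord_recl /= bin0 subn0; congr (_ + _).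
by apply: eq_bigr => k _; rewrite /= /bump leq0n add1n -subSn // subSS.
Qed.

Lemma binom_convC (R : comNzRingType) (u v : nat -> R) n :
  binom_conv u v n = binom_conv v u n.
Proof.
rewrite /binom_conv (reindex_inj rev_ord_inj); apply: eq_bigr => k _ /=.
have kn : (k <= n)%N by rewrite -ltnS.
by rewrite subSS (subKn kn) (bin_sub kn) mulrAC.
Qed.

(** Induction on [n] avoids reindexing a double sum: the Leibniz rule turns each side at [n.+1] into
    three triple products at [n], which the induction hypothesis matches in pairs. *)
Lemma binom_convCA (R : comNzRingType) (u v w : nat -> R) n :
  binom_conv u (binom_conv v w) n = binom_conv v (binom_conv u w) n.
Proof.
elim: n u v w => [|n IHn] u v w.
  by rewrite /binom_conv !big_ord1 /=; ring.
rewrite !binom_convS.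
rewrite (eq_binom_convr _ u _ _ _ (binom_convS _ v w)).
rewrite (eq_binom_convr _ v _ _ _ (binom_convS _ u w)).
by rewrite !binom_convDr !(IHn u) IHn addrCA.
Qed.

Lemma fps_mul_egf (F : numFieldType) (u v : nat -> F) n :
  fps_mul (egf u) (egf v) n = egf (binom_conv u v) n.
Proof.
rewrite /fps_mul /egf /binom_conv mulr_suml; apply: eq_bigr => k _.
have f_neq0 m : m`!%:R != 0 :> F by rewrite Num.Theory.pnatr_eq0 -lt0n fact_gt0.
have kn : (k <= n)%N by rewrite -ltnS.
rewrite -(bin_fact kn) !natrM.
(* The binomial coefficient is nonzero in [F] because it is a factor of [n]!, which is nonzero in
   characteristic zero. *)
have := f_neq0 n; rewrite -(bin_fact kn) !natrM !mulf_eq0 !negb_or => /andP[C0 _].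
by field; rewrite C0 !f_neq0.
Qed.

Lemma fps_deriv_egf (F : numFieldType) (u : nat -> F) n :
  fps_deriv (egf u) n = egf (fun k => u k.+1) n.
Proof.
by rewrite /fps_deriv /egf factS natrM invfM mulrCA mulVKf ?Num.Theory.pnatr_eq0.
Qed.

Lemma egf_inj (F : numFieldType) (u v : nat -> F) n :
  egf u n = egf v n -> u n = v n.
Proof.
by apply: mulIf; rewrite invr_eq0 Num.Theory.pnatr_eq0 -lt0n fact_gt0.
Qed.

Lemma pochhammerS (F : fieldType) (r : F) k :
  pochhammer r k.+1 = r * pochhammer (r + 1) k.
Proof.
rewrite /pochhammer big_ord_recl addr0; congr (_ * _).
by apply: eq_bigr => i _; rewrite lift0 -natr1 -addrA [1 + _]addrC.
Qed.

Definition hypergeom_weight {F : fieldType} (a b c x : F) (k : nat) : F :=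
  pochhammer a k * pochhammer b k / pochhammer c k * x ^+ k.

Lemma hypergeom_weightS (F : fieldType) (a b c x : F) k :
  hypergeom_weight a b c x k.+1 =
  a * b * x / c * hypergeom_weight (a + 1) (b + 1) (c + 1) x k.
Proof.
by rewrite /hypergeom_weight !pochhammerS exprS invfM; ring.
Qed.

Lemma gauss_appell_conv (F : fieldType) (A : nat -> F) n (a b c x : F) :
  gauss_appell A n a b c x = binom_conv (hypergeom_weight a b c x) A n.
Proof.
by rewrite gauss_appellE; apply: eq_bigr => k _; rewrite -(mulrA 'C(n, k)%:R).
Qed.

Theorem theorem2 (R : realType) (A beta : nat -> R[i])
    (hA : forall n : nat,
      fps_deriv (egf A) n = fps_mul (egf A) (egf beta) n)
    (a b c x : R[i]) (hc : forall m : nat, c != - m%:R) (n : nat) :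
  gauss_appell A n.+1 a b c x =
    a * b * x / c * gauss_appell A n (a + 1) (b + 1) (c + 1) x
    + \sum_(k < n.+1) 'C(n, k)%:R * beta k * gauss_appell A (n - k) a b c x.
Proof.
(* The equation A' = A B, freed of its factorial denominators. *)
have AS m : A m.+1 = binom_conv beta A m.
  rewrite binom_convC; apply: (egf_inj _ (fun k => A k.+1)).
  by rewrite -fps_deriv_egf hA fps_mul_egf.
rewrite !gauss_appell_conv binom_convS; congr (_ + _).
  by rewrite (eq_binom_convl _ _ _ _ _ (hypergeom_weightS _ a b c x)) binom_convZl.
rewrite (eq_binom_convr _ _ _ _ _ AS).
(* Moving [beta] outermost leaves the weights convolved with [A] inside, which is again a
   Gauss-Appell polynomial, of index [n - k]. *)
rewrite binom_convCA; apply: eq_bigr => k _.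
by rewrite gauss_appell_conv.
Qed.
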